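(* There is a LOTS that is monotonically metacompact but not metrizable.
   Context: A LOTS (linearly ordered topological space) is a linearly ordered set equipped with the usual open interval topology of its ordering. For two collections of sets $\mathcal{U}$ and $\mathcal{V}$, write $\mathcal{U} \prec \mathcal{V}$ if for each $U \in \mathcal{U}$ there is some $V \in \mathcal{V}$ with $U \subseteq V$. A space $X$ is monotonically metacompact (in the sense of Popvassilev) if there is a function $r$ that associates with each open cover $\mathcal{U}$ of $X$ a point-finite collection $r(\mathcal{U})$ of open sets that covers $X$ and satisfies $r(\mathcal{U}) \prec \mathcal{U}$, in such a way that if $\mathcal{U}$ and $\mathcal{V}$ are open covers of $X$ with $\mathcal{U} \prec \mathcal{V}$, then $r(\mathcal{U}) \prec r(\mathcal{V})$. *)

(* Defs.v *)
From mathcomp Require Import all_boot all_order all_algebra.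
From mathcomp Require Import all_classical reals topology.

Set Implicit Arguments.
Unset Strict Implicit.
Unset Printing Implicit Defensive.

Local Open Scope classical_set_scope.

(* Collections of subsets of T have type set (set T): unindexed, and with no
   restriction on cardinality. *)

Definition refines (T : Type) (U V : set (set T)) : Prop :=
  forall A, U A -> exists2 B, V B & A `<=` B.

Definition point_finite (T : Type) (U : set (set T)) : Prop :=
  forall x : T, finite_set [set A | U A /\ A x].

Definition open_cover (T : topologicalType) (U : set (set T)) : Prop :=
  (forall A, U A -> open A) /\ cover U id = [set: T].

(* The values of r on collections that are not open covers are irrelevant. *)
Definition monotonically_metacompact (T : topologicalType) : Prop :=
  exists r : set (set T) -> set (set T),
    (forall U, open_cover U ->
       [/\ open_cover (r U), point_finite (r U) & refines (r U) U]) /\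
    (forall U V, open_cover U -> open_cover V ->
       refines U V -> refines (r U) (r V)).

(* T is homeomorphic to a metric space. Any two real number structures are
   isomorphic, so it does not matter which R the distance takes its values in;
   R is left existential so that the negation excludes every choice of R. *)
Definition metrizable (T : topologicalType) : Prop :=
  exists (R : realType) (M : metricType R) (f : T -> M) (g : M -> T),
    [/\ cancel f g, cancel g f, continuous f & continuous g].

(* Main.v *)
(* Let W be the first uncountable ordinal: a well-order in which every countable
   set has a strict upper bound.  Order W x Z lexicographically and add a last
   point.  The points of W x Z are isolated, and the rays above (w, 0), for w in
   W, are a base at the last point.  Given a cover, keep all isolated points as
   singletons, and add the ray with the least w among those contained in a
   member of the cover; a coarser cover has a larger such ray.  The last point
   has no countable base of neighborhoods, so the space is not metrizable. *)
Require Import Defs.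
From HB Require Import structures.
From mathcomp Require Import all_boot all_order all_algebra.
From mathcomp Require Import zify.
From mathcomp Require Import all_classical wochoice reals topology.

Set Implicit Arguments.
Unset Strict Implicit.
Unset Printing Implicit Defensive.

Import Order.TTheory GRing.Theory Num.Theory.

Local Open Scope classical_set_scope.

(** * Criteria at a single point *)

(** The maximum condition on [B] makes the choice canonical: take the largest member of [B] inside a
    member of the cover. Coarsening the cover adds candidates, so this set only grows. *)
Lemma monotonically_metacompact_isolated (T : topologicalType) (p : T)
    (B : set (set T)) :
  (forall x, x <> p -> open [set x]) ->
  (forall C, B C -> open C /\ C p) ->
  (forall U, nbhs p U -> exists2 C, B C & C `<=` U) ->
  (forall A, A `<=` B -> A !=set0 -> exists2 C, A C & forall D, A D -> D `<=` C) ->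
  monotonically_metacompact T.
Proof.
move=> isoT Bp Bbase Bmax.
pose sub (U : set (set T)) (C : set T) := B C /\ exists2 V, U V & C `<=` V.
pose top U C := sub U C /\ forall D, sub U D -> D `<=` C.
have topP U : open_cover U -> exists C, top U C.
  move=> [oU cU]; have [V UV Vp] : cover U id p by rewrite cU.
  have [C BC CV] := Bbase V (open_nbhs_nbhs (conj (oU _ UV) Vp)).
  have [|D subD topD] := Bmax (sub U) (fun C => @proj1 _ _).
    by exists C; split=> //; exists V.
  by exists D.
exists (fun U => [set A | (exists2 x, x <> p & A = [set x]) \/ top U A]); split.
  move=> U oU; have [C topC] := topP U oU; have [[BC [V UV CV]] maxC] := topC.
  split.
  - split.
      by move=> A [[x xp ->]|[[BA _] _]]; [exact: isoT|case: (Bp _ BA)].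
    apply/seteqP; split=> // x _; have [->|/eqP xp] := eqVneq x p.
      by exists C; [right|case: (Bp _ BC)].
    by exists [set x] => //; left; exists x.
  (* A point lies in at most two members: its own singleton and [C], the only set satisfying
     [top U]. *)
  - move=> x; apply: (@sub_finite_set _ _ [set [set x]; C]).
      move=> A [[[y _ ->] -> |[subA maxA] _]]; first by left.
      by right; apply/seteqP; split; [exact: maxC|exact: maxA (proj1 topC)].
    by rewrite finite_setU; split; exact: finite_set1.
  - move=> A [[x _ ->]|[[BA [W UW AW]] _]]; last by exists W.
    have [W UW Wx] : cover U id x by rewrite (proj2 oU).
    by exists W => // y ->.
move=> U V _ oV UV A [isoA|[[BA [W UW AW]] _]]; first by exists A => //; left.
have [C topC] := topP V oV; exists C; first by right.
have [W' VW' WW'] := UV W UW.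
by apply: (proj2 topC); split=> //; exists W' => //; exact: subset_trans WW'.
Qed.

(** Pull back the balls of radius 1/(n+1) about [f p]. *)
Lemma metrizable_nbhs_countable (T : topologicalType) (p : T) :
  metrizable T ->
  exists N : nat -> set T, (forall n, nbhs p (N n)) /\
    forall U, nbhs p U -> exists n, N n `<=` U.
Proof.
move=> [R [M [f [g [fK gK cf cg]]]]].
exists (fun n => f @^-1` ball (f p) (n.+1%:R^-1 : R)%R); split=> [n|U pU].
  by apply: (cf p); apply: nbhsx_ballx; rewrite invr_gt0.
have /cg : nbhs (g (f p)) U by rewrite fK.
move=> /nbhs_ballP[e /= e0 eU].
exists (Num.truncn e^-1) => x fx; rewrite -(fK x); apply: eU.
by apply: le_ball fx; rewrite invf_ple ?posrE// ltW// truncnS_gt.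
Qed.

(** * Well-orders and the first uncountable ordinal *)

Lemma well_order_transitive (T : eqType) (R : rel T) :
  well_order R -> transitive R.
Proof.
move=> Rwo y x z xy yz.
(* Whichever of the three points is least, antisymmetry settles the claim. *)
have /Rwo[m [[mA lbm] _]] : nonempty [pred t | t \in [:: x; y; z]].
  by exists x; rewrite !inE eqxx.
have Ranti : antisymmetric R.
  move=> a b; apply: (@wo_chain_antisymmetric T R predT) => //.
  by move=> A _; exact: Rwo.
have [mx my mz] : [/\ R m x, R m y & R m z].
  by split; apply: lbm; rewrite !inE eqxx ?orbT.
move: mA; rewrite !inE => /or3P[] /eqP mE; subst m => //.
  by rewrite (Ranti x y) ?xy ?mx.
by rewrite (Ranti z y) ?yz ?my // in xy *.
Qed.

(* Truncating a well-order on an uncountable set to the points with countably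
   many predecessors gives the first uncountable ordinal. *)
Lemma uncountable_well_order :
  exists (S : choiceType) (R : rel S), well_order R /\
    forall A : set S, countable A -> exists s, forall a, A a -> ~~ R s a.
Proof.
have [R Rwo] := well_ordering_principle (nat -> bool).
have Rtot : total R.
  by move=> x y; apply: (@wo_chainW _ R predT) => // A _; exact: Rwo.
have Ranti : antisymmetric R.
  move=> x y; apply: (@wo_chain_antisymmetric _ R predT) => //.
  by move=> A _; exact: Rwo.
pose D (x : nat -> bool) := countable [set y | R y x].
exists {x | D x}, (relpre val R); split.
  apply: antisymmetric_well_order => [x y xy|A [a aA]].
    exact/val_inj/Ranti.
  have [|m [[/= /asboolP[b bA bm] lbm] _]] :=
      Rwo (fun x => `[< exists2 a, a \in A & val a = x >]).
    by exists (val a); apply/asboolP; exists a.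
  exists b; split=> // c cA; rewrite /= bm; apply: lbm.
  by apply/asboolP; exists c.
move=> A cA; apply: contrapT => /forallNP noub.
(* Without a strict upper bound for [A], the countable initial segments of its members exhaust
   [D]. *)
pose E := \bigcup_(a in A) [set y | R y (val a)].
have cE : countable E.
  by apply: bigcup_countable => // -[].
have DE : [set x | D x] `<=` E.
  move=> x Dx; have := noub (exist _ x Dx).
  by move=> /existsNP[a /not_implyP[Aa /negP]]; rewrite negbK; exists a.
(* Cantor's diagonal sequence [c], evaluated at [h c], refutes this countability. *)
suff /countable_injP[h hinj] : countable [set: nat -> bool].
  pose c n := ~~ `[< exists2 x : nat -> bool, h x = n & x n >].
  have : c (h c) <-> ~ c (h c).
    rewrite {1}/c; split.
      by move=> /asboolPn nh ch; apply: nh; exists c.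
    move=> nc; apply/asboolPn => -[x /hinj xc]; rewrite xc ?inE//.
  by case=> ab ba; have nc : ~ c (h c) by [move=> /[dup] /ab]; exact/nc/ba.
have [DT|/existsNP[x0 nx0]] := pselect (forall x, D x).
  by apply: sub_countable cE; apply: subset_card_le => x _; exact/DE/DT.
(* All points strictly below the least [m] outside [D] lie in [E], so [m] has countably many
   predecessors after all. *)
have [|m [[mA lbm] _]] := Rwo (fun x => ~~ D x).
  by exists x0; apply/negP.
exfalso; move/negP: mA; apply.
apply: (@sub_countable _ _ _ (E `|` [set m])).
  apply: subset_card_le => y /= ym.
  have [->|yNm] := eqVneq y m; [by right|left; apply: DE => /=].
  apply: contrapT => /negP nDy; move: yNm.
  by rewrite (Ranti y m) ?eqxx// ym; exact: lbm.
by rewrite -bigcup2E; apply: bigcup_countable => // -[|[|n]] _ /=.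
Qed.

(** * Order structures: the well-order, and an added greatest element *)

Section order_of_well_order.
Context (S : choiceType) (R : rel S).

(** The proof is a phantom parameter, so that the type alone determines the order put on this copy
    of [S]. *)
Definition well_ordered of well_order R : Type := S.

Context (Rwo : well_order R).
Local Notation W := (well_ordered Rwo).

HB.instance Definition _ := Choice.on W.

Let Rwo_chain : wo_chain R predT.
Proof. by move=> A _; exact: Rwo. Qed.

Let le_anti : antisymmetric R.
Proof. by move=> x y; exact: (wo_chain_antisymmetric Rwo_chain). Qed.

Let le_total : total R.
Proof. by move=> x y; exact: (wo_chainW Rwo_chain). Qed.

Let le_refl : reflexive R.
Proof. by move=> x; exact: (wo_chain_reflexive Rwo_chain). Qed.

Fact well_ordered_display : Order.disp_t. Proof. exact. Qed.

HB.instance Definition _ := @Order.Le_isPOrder.Build well_ordered_display W R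
  le_refl le_anti (well_order_transitive Rwo).
HB.instance Definition _ :=
  @Order.POrder_isTotal.Build well_ordered_display W le_total.

End order_of_well_order.

Section with_top.
Context (d : Order.disp_t) (L : orderType d).

Definition with_top : Type := option L.

HB.instance Definition _ := Choice.on with_top.

Definition with_top_le (x y : with_top) : bool :=
  match x, y with
  | _, None => true
  | None, Some _ => false
  | Some a, Some b => (a <= b)%O
  end.

Let le_refl : reflexive with_top_le.
Proof. by case=> /=. Qed.

Let le_anti : antisymmetric with_top_le.
Proof. by case=> [a|] [b|] //= /le_anti ->. Qed.

Let le_trans : transitive with_top_le.
Proof. by case=> [a|] [b|] [c|] //=; exact: le_trans. Qed.

Let le_total : total with_top_le.
Proof. by case=> [a|] [b|] //=; exact: le_total. Qed.

HB.instance Definition _ := @Order.Le_isPOrder.Build d with_top with_top_le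
  le_refl le_anti le_trans.
HB.instance Definition _ := @Order.POrder_isTotal.Build d with_top le_total.

Lemma lt_Some (a b : L) : ((Some a : with_top) < (Some b : with_top))%O = (a < b)%O.
Proof. by rewrite !lt_neqAle. Qed.

Lemma lt_None (a : L) : ((Some a : with_top) < (None : with_top))%O.
Proof. by rewrite lt_neqAle. Qed.

Lemma None_lt (x : with_top) : ((None : with_top) < x)%O = false.
Proof. by case: x => [a|]; rewrite lt_neqAle ?andbF. Qed.

End with_top.

(** * The long space and its last point *)

Section long_space.
Context (d : Order.disp_t) (W : orderType d).

(** The factor [int] gives every point but the last an immediate predecessor and successor. *)
Definition long_space : Type := order_topology (with_top (W *l int)).

HB.instance Definition _ := OrderTopological.on long_space.

Let pt (w : W) (n : int) : long_space := Some (w, n).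
Let infty : long_space := None.
Let ray (w : W) : set long_space := [set` `]pt w 0%R, +oo[%O].

Let lt_pt w n w' n' :
  (pt w n < pt w' n')%O = (w <= w')%O && ((w' <= w)%O ==> (n < n')%O).
Proof. by etransitivity; [exact: lt_Some|exact: ltxi_pair]. Qed.

Let lt_infty w n : (pt w n < infty)%O.
Proof. exact: lt_None. Qed.

Let infty_lt x : (infty < x)%O = false.
Proof. exact: None_lt. Qed.

Let rayE w x : ray w x = (pt w 0%R < x)%O.
Proof. by rewrite /ray /= in_itv /= andbT. Qed.

Let ray_open w : open (ray w).
Proof. exact: rray_open. Qed.

Let ray_infty w : ray w infty.
Proof. by rewrite rayE. Qed.

Let subset_ray v w : (w <= v)%O -> ray v `<=` ray w.
Proof.
move=> wv [[u n]|]; rewrite !rayE; last by rewrite lt_infty.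
rewrite -/(pt u n) !lt_pt => /andP[vu /implyP uvn].
rewrite (le_trans wv vu); apply/implyP => uw.
by apply: uvn; exact: le_trans uw wv.
Qed.

Let isolated x : x <> infty -> open [set x].
Proof.
case: x => [[w n]|//] _; rewrite -/(pt w n).
rewrite (_ : [set _] = [set` `]pt w (n - 1)%R, pt w (n + 1)%R[%O]); last first.
  apply/seteqP; split=> [_ ->|[[u m]|]] /=; rewrite in_itv /=.
  - by rewrite !lt_pt lexx /=; lia.
  - rewrite -/(pt u m) !lt_pt => /andP[/andP[wu +] /andP[uw +]].
    rewrite wu uw /= => nm mn; have -> : u = w by apply/le_anti/andP.
    by congr (pt w _); lia.
  - by rewrite infty_lt.
exact: (@itv_open _ long_space).
Qed.

Hypothesis W_well_founded : forall A : set W, A !=set0 ->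
  exists2 w, A w & forall v, A v -> (w <= v)%O.
Hypothesis W_unbounded : forall A : set W, countable A ->
  exists w, forall a, A a -> (a < w)%O.

Let ray_base U : nbhs infty U -> exists w, ray w `<=` U.
Proof.
rewrite itv_nbhsE => -[[l [b r|[]]] [lr]]; rewrite itv_boundlr => /andP[li ri] iU.
- by move: ri; rewrite (itv_open_ends_rside lr) bnd_simp infty_lt.
- by [].
- case: l li lr iU => [b [[w n]|]|[]] //; first last.
  (* Here [U] is the whole space; bounding the empty set merely yields some element of [W]. *)
  + move=> _ _ iU; have [w _] := W_unbounded (countable0 W).
    by exists w => x _; apply: iU; rewrite /= in_itv.
  + move=> li /itv_open_ends_lside b0 _; rewrite b0 in li.
    by have : (infty < infty)%O := li; rewrite infty_lt.
  + move=> _ /itv_open_ends_lside -> iU; rewrite -/(pt w n) in iU.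
    (* A strictly larger [v] puts [pt v 0] above [pt w n] whatever [n] is. *)
    have [v wv] := W_unbounded (countable1 w); exists v => x; rewrite rayE => vx.
    apply: iU; rewrite /= in_itv /= andbT; apply: lt_trans vx.
    by rewrite lt_pt ltW ?leNgt ?wv.
Qed.

Lemma long_space_monotonically_metacompact :
  monotonically_metacompact long_space.
Proof.
apply: (@monotonically_metacompact_isolated _ infty (range ray)).
- exact: isolated.
- by move=> _ [w _ <-].
- by move=> U /ray_base[w wU]; exists (ray w) => //; exists w.
- move=> A Aray [_ /[dup]/Aray[w _ <-] Aw].
  (* Rays shrink as the index grows, so the least index gives the largest ray. *)
  have [|v Av vmin] := @W_well_founded [set w | A (ray w)]; first by exists w.
  exists (ray v) => // _ /[dup]/Aray[u _ <-] Au.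
  exact/subset_ray/vmin.
Qed.

Lemma long_space_not_metrizable : ~ metrizable long_space.
Proof.
move=> /(@metrizable_nbhs_countable _ infty)[N [Ninfty Nbase]].
have /boolp.choice[u uN] n : exists w, ray w `<=` N n by exact: ray_base.
(* With [w] above every [u n], the point [pt w 0] lies in every [N n] but not in [ray w]. *)
have [|w uw] := @W_unbounded (range u).
  by apply: sub_countable (countableP [set: nat]); exact: card_image_le.
have [|n Nw] := Nbase (ray w); first exact: open_nbhs_nbhs.
suff : ray w (pt w 0%R) by rewrite rayE ltxx.
by apply: Nw; apply: uN; rewrite rayE lt_pt ltW ?leNgt uw //; exists n.
Qed.

End long_space.

(* A LOTS is an orderTopologicalType: a totally ordered type whose
   neighborhoods are generated by the open intervals and open rays. *)
Theorem mainTheorem6 :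
  exists (d : Order.disp_t) (T : orderTopologicalType d),
    monotonically_metacompact T /\ ~ metrizable T.
Proof.
have [S [R [Rwo Rub]]] := uncountable_well_order.
pose W := well_ordered Rwo.
have Wwf (A : set W) : A !=set0 -> exists2 w, A w & forall v, A v -> (w <= v)%O.
  move=> [a Aa]; have [|w [[/asboolP Aw lbw] _]] := Rwo (fun x => `[< A x >]).
    by exists a; exact/asboolP.
  by exists w => // v Av; apply: lbw; exact/asboolP.
have Wub (A : set W) : countable A -> exists w, forall a, A a -> (a < w)%O.
  by move=> /Rub[w Aw]; exists w => a Aa; rewrite ltNge; exact: Aw.
exists _, (long_space W); split.
  exact: long_space_monotonically_metacompact.
exact: long_space_not_metrizable.
Qed.
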